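(* Let $A\in\mathbb{R}^{n\times n}$, $b,x_0\in\mathbb{R}^n$, $r_0=b-Ax_0$, and let $w_0\in\{r_0,\,Ar_0\}$. Let $\mathcal{V}_j=\mathcal{K}_j(A,w_0)$, and let $V_{j+1}\in\mathbb{R}^{n\times(j+1)}$ and $\underline{H}_j\in\mathbb{R}^{(j+1)\times j}$ be generated by $j$ steps of the Arnoldi process (without breakdown) applied to $A$ with starting vector $w_0$, so that $AV_j=V_{j+1}\underline{H}_j$. Let $U\in\mathbb{R}^{n\times k}$ be such that $C=AU$ has orthonormal columns, let $\mathcal{U}$ be the column space of $U$, and put $\Phi=CC^T$ and $D_j=V_{j+1}^TC$. Then minimizing the residual over $\mathcal{U}+\mathcal{V}_j$ is equivalent to computing $y_j$ and $z_j$ as follows: for $y_j\in\mathbb{R}^j$ and $z_j\in\mathbb{R}^k$, the pair $(y_j,z_j)$ minimizes $$\left\|b-A\left(x_0+V_jy+Uz\right)\right\|_2$$ over all $y\in\mathbb{R}^j$, $z\in\mathbb{R}^k$ if and only if $$\left(\underline{H}_j^T\underline{H}_j-\underline{H}_j^TD_jD_j^T\underline{H}_j\right)y_j=\underline{H}_j^T\left(V_{j+1}^T(I-\Phi)r_0\right)\quad\text{and}\quad z_j=C^Tr_0-D_j^T\underline{H}_jy_j .$$ Furthermore, the first of these two equations holds for $y_j$ if and only if $t_j=V_jy_j\in\mathcal{V}_j$ is a minimizer over $t\in\mathcal{V}_j$ of $$\left\|(I-\Phi)\left(b-A(x_0+t)\right)\right\|_2 .$$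
   Context: For a matrix $A\in\mathbb{R}^{n\times n}$ and a vector $w_0\in\mathbb{R}^n$, the Krylov subspace is $\mathcal{K}_j(A,w_0)=\mathrm{span}\{w_0,Aw_0,\dots,A^{j-1}w_0\}$. The Arnoldi process starting from $v_1=w_0/\|w_0\|_2$ produces (when it has not broken down) a matrix $V_{j+1}=[v_1,\dots,v_{j+1}]\in\mathbb{R}^{n\times(j+1)}$ with orthonormal columns, such that the columns of $V_i=[v_1,\dots,v_i]$ form an orthonormal basis of $\mathcal{K}_i(A,w_0)$ for $i\le j+1$, and an upper Hessenberg matrix $\underline{H}_j\in\mathbb{R}^{(j+1)\times j}$ of orthogonalization coefficients with nonzero subdiagonal entries $h_{i+1,i}$, satisfying the Arnoldi relation $AV_j=V_{j+1}\underline{H}_j$. Minimizing the residual over the sum $\mathcal{U}+\mathcal{V}_j$ means choosing $s_j=Uz_j\in\mathcal{U}$ and $t_j=V_jy_j\in\mathcal{V}_j$ such that $\|b-A(x_0+s_j+t_j)\|_2$ is minimal, equivalently $b-A(x_0+s_j+t_j)\perp A(\mathcal{U}+\mathcal{V}_j)$. The matrix $\Phi=CC^T$ is the orthogonal projector onto $A\,\mathcal{U}$. *)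

(* Defs.v *)
From HB Require Import structures.
From mathcomp Require Import all_boot all_order all_algebra.
From mathcomp Require Import reals.

Set Implicit Arguments.
Unset Strict Implicit.
Unset Printing Implicit Defensive.
Import Order.TTheory GRing.Theory Num.Theory.
Local Open Scope ring_scope.

(* Euclidean norm; the library norm `|x| on matrices is the sup norm. *)
Definition norm2 (R : realType) (n : nat) (x : 'cV[R]_n) : R :=
  Num.sqrt (\sum_i x i 0 ^+ 2).

Definition krylov (R : realType) (n j : nat) (A : 'M[R]_n) (w : 'cV[R]_n) :
    {vspace 'cV[R]_n} :=
  <<[seq A ^+ i *m w | i <- iota 0 j]>>%VS.

Definition colspace (R : realType) (n k : nat) (U : 'M[R]_(n, k)) :
    {vspace 'cV[R]_n} :=
  <<[seq col i U | i <- enum 'I_k]>>%VS.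

(* V_j = [v_1, ..., v_j], obtained from V_{j+1} by dropping the last column. *)
Definition init_cols (R : realType) (n j : nat) (V : 'M[R]_(n, j.+1)) :
    'M[R]_(n, j) :=
  colsub (widen_ord (leqnSn j)) V.

(* One orthogonalization step: the vector A v_m is orthogonalized against
   v_0, ..., v_m (indices start at 0), the remainder being h_{m+1,m} v_{m+1}.
   The condition h_{m+1,m} != 0 says that there is no breakdown. The sign of
   h_{m+1,m} is left free (Gram-Schmidt takes it positive, Householder
   variants need not). *)
Definition arnoldi_step (R : realType) (n j : nat) (A : 'M[R]_n)
    (V : 'M[R]_(n, j.+1)) (H : 'M[R]_(j.+1, j)) (m : 'I_j) : Prop :=
  let Av := A *m col m (init_cols V) in
  let m1 : 'I_j.+1 := lift ord0 m in
  [/\ forall i : 'I_j.+1, (i <= m)%N -> H i m = ((col i V)^T *m Av) 0 0,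
      H m1 m *: col m1 V = Av - \sum_(i < j.+1 | (i <= m)%N) H i m *: col i V,
      norm2 (col m1 V) = 1,
      H m1 m != 0 &
      forall i : 'I_j.+1, (m.+1 < i)%N -> H i m = 0].

(* (V, H) = (V_{j+1}, H_j) results from j Arnoldi steps without breakdown.
   Orthonormality of V, the relation A V_j = V_{j+1} H_j and
   span(v_1, ..., v_i) = K_i(A, w0) are consequences of this definition. *)
Definition arnoldi (R : realType) (n j : nat) (A : 'M[R]_n) (w0 : 'cV[R]_n)
    (V : 'M[R]_(n, j.+1)) (H : 'M[R]_(j.+1, j)) : Prop :=
  [/\ w0 != 0,
      col ord0 V = (norm2 w0)^-1 *: w0 &
      forall m : 'I_j, arnoldi_step A V H m].

Definition minimizer_on (R : realType) (T : Type) (S : T -> Prop) (f : T -> R)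
    (x : T) : Prop :=
  S x /\ forall x' : T, S x' -> f x <= f x'.

(* Main.v *)
(* Both minimizations are linear least squares problems, whose solutions are
   the solutions of the normal equations [M^T (r - M p) = 0]. The Arnoldi
   relation turns the first one, over [V_j y + U z], into the problem with
   matrix [[V_{j+1} H, C]]; eliminating [z] from its normal equations (possible
   since [C^T C = I]) leaves the equation for [y], which is also the normal
   equation of the problem projected by the orthogonal projector [I - Phi]. *)
Require Import Defs.
From HB Require Import structures.
From mathcomp Require Import all_boot all_order all_algebra.
From mathcomp Require Import reals.
From mathcomp Require Import ring lra.

Set Implicit Arguments.
Unset Strict Implicit.
Unset Printing Implicit Defensive.
Import Order.TTheory GRing.Theory Num.Theory.
Local Open Scope ring_scope.

(** * Linear least squares and the normal equations *)

Section LeastSquares.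
Variable R : realType.

Lemma sqnormE n (x : 'cV[R]_n) : (x^T *m x) 0 0 = \sum_i x i 0 ^+ 2.
Proof. by rewrite mxE; apply: eq_bigr => i _; rewrite mxE expr2. Qed.

Lemma sqnorm_ge0 n (x : 'cV[R]_n) : 0 <= (x^T *m x) 0 0.
Proof. by rewrite sqnormE sumr_ge0 // => i _; rewrite sqr_ge0. Qed.

Lemma sqnorm_eq0 n (x : 'cV[R]_n) : (x^T *m x) 0 0 = 0 -> x = 0.
Proof.
rewrite sqnormE => /eqP; rewrite psumr_eq0 => [/allP x0|i _]; last first.
  exact: sqr_ge0.
apply/colP => i; rewrite [RHS]mxE; apply/eqP.
by have := x0 i (mem_index_enum i); rewrite sqrf_eq0.
Qed.

Lemma norm2_sqr n (x : 'cV[R]_n) : norm2 x ^+ 2 = (x^T *m x) 0 0.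
Proof. by rewrite /norm2 -sqnormE sqr_sqrtr ?sqnorm_ge0. Qed.

Lemma norm2_le n (x y : 'cV[R]_n) :
  (norm2 x <= norm2 y) = ((x^T *m x) 0 0 <= (y^T *m y) 0 0).
Proof. by rewrite /norm2 ler_sqrt -!sqnormE ?sqnorm_ge0. Qed.

Lemma sqnormD n (x y : 'cV[R]_n) :
  ((x + y)^T *m (x + y)) 0 0 =
  (x^T *m x) 0 0 + 2 * (y^T *m x) 0 0 + (y^T *m y) 0 0.
Proof.
have xy : (x^T *m y) 0 0 = (y^T *m x) 0 0.
  by rewrite -[in RHS](trmxK x) -trmx_mul [RHS]mxE.
rewrite [(x + y)^T]linearD /= mulmxDl !mulmxDr.
by rewrite mxE [X in X + _]mxE [X in _ + X]mxE xy; ring.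
Qed.

Lemma sqnormZ n (c : R) (x : 'cV[R]_n) :
  ((c *: x)^T *m (c *: x)) 0 0 = c ^+ 2 * (x^T *m x) 0 0.
Proof.
by rewrite [(c *: x)^T]linearZ /= -scalemxAl -scalemxAr scalerA mxE expr2.
Qed.

(** At [t = a / (c + 1)] the quadratic equals [- t ^+ 2 * (c + 2)], so its nonnegativity forces
    [t = 0]. The shift by one covers [c = 0]. *)
Lemma quadratic_ge0_linear0 (c a : R) : 0 <= c ->
  (forall t, 0 <= - (2 * (t * a)) + t * t * c) -> a = 0.
Proof.
move=> c0 quad; have c1 : c + 1 != 0 by apply: lt0r_neq0; lra.
have ta : a = a / (c + 1) * (c + 1) by rewrite divfK.
have := quad (a / (c + 1)).
move: (a / (c + 1)) ta => t -> le_t.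
have t2c : 0 <= t * t * c by rewrite mulr_ge0 // -expr2 sqr_ge0.
have t2 : t ^+ 2 <= 0 by rewrite expr2; lra.
have /eqP -> : t == 0 by rewrite -sqrf_eq0 eq_le t2 sqr_ge0.
by rewrite mul0r.
Qed.

(** Around [p] the squared residual is a quadratic in the increment [q], with linear part
    [- 2 q^T (M^T e)] and quadratic part the squared norm of [M q]. A minimum at [q = 0] means that
    the linear part vanishes. *)
Lemma normal_equationP n m (M : 'M[R]_(n, m)) (r : 'cV[R]_n) (p : 'cV[R]_m) :
  (forall q, norm2 (r - M *m p) <= norm2 (r - M *m q)) <->
  M^T *m (r - M *m p) = 0.
Proof.
set e := r - M *m p.
have eD q : r - M *m (p + q) = e + M *m (- q).
  by rewrite mulmxDr mulmxN opprD addrA.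
have sq q : ((r - M *m (p + q))^T *m (r - M *m (p + q))) 0 0 =
    (e^T *m e) 0 0 - 2 * (q^T *m (M^T *m e)) 0 0
    + ((M *m q)^T *m (M *m q)) 0 0.
  rewrite eD sqnormD mulmxN [(- (M *m q))^T]linearN /= !mulNmx mulmxN opprK.
  by rewrite [X in 2 * X]mxE mulrN [X in 2 * (X *m e) 0 0]trmx_mul -(mulmxA q^T).
split=> [pmin|ne0 q]; last first.
  rewrite norm2_le -(subrKC p q) (sq (q - p)) ne0 mulmx0 [X in 2 * X]mxE mulr0.
  by rewrite subr0 lerDl sqnorm_ge0.
(* Moving from [p] by [t *: g], along the direction of steepest descent, gives a quadratic in [t]
   whose linear coefficient is a multiple of the squared norm of [g]. *)
set g := M^T *m e.
apply: sqnorm_eq0; rewrite -/g.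
apply: (quadratic_ge0_linear0 (sqnorm_ge0 (M *m g))) => t.
have := pmin (p + t *: g); rewrite norm2_le (sq (t *: g)) -/g -addrA lerDl.
rewrite -[M *m (t *: g)]scalemxAr sqnormZ [(t *: g)^T]linearZ /= -scalemxAl.
have -> : (t *: (g^T *m g)) 0 0 = t * (g^T *m g) 0 0 by rewrite mxE.
by rewrite expr2.
Qed.

(** Passes from a subspace to coordinates, the form in which [normal_equationP] applies. Repeated
    values of [g] are allowed, as the sum of the two subspaces may fail to be direct. *)
Lemma minimizer_on_image (S T : Type) (P : T -> Prop) (g : S -> T) (f : T -> R)
    (s : S) :
  (forall t, P t <-> exists s, t = g s) ->
  minimizer_on P f (g s) <-> forall s', f (g s) <= f (g s').
Proof.
move=> Pg; split=> [[_ smin] s'|smin].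
  by apply: smin; apply/Pg; exists s'.
by split=> [|t /Pg[s' ->]//]; apply/Pg; exists s.
Qed.

End LeastSquares.

(** * Krylov subspaces and the Arnoldi process *)

Section Arnoldi.
Variable R : realType.

Lemma colspaceP n k (U : 'M[R]_(n, k)) (x : 'cV[R]_n) :
  x \in colspace U <-> exists z, x = U *m z.
Proof.
suff -> : colspace U = limg (linfun (mulmx U : 'cV[R]_k -> 'cV[R]_n)).
  split=> [/memv_imgP[z _ ->]|[z ->]]; first by exists z; rewrite lfunE.
  by rewrite -[U *m z]lfunE; apply: memv_img; exact: memvf.
apply/eqP; rewrite eqEsubv; apply/andP; split.
  apply/span_subvP => _ /mapP[i _ ->].
  by rewrite colE -[U *m _]lfunE memv_img ?memvf.
apply/subvP => _ /memv_imgP[z _ ->]; rewrite lfunE /=.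
have -> : U *m z = \sum_i z i 0 *: col i U.
  apply/colP => l; rewrite mxE summxE; apply: eq_bigr => i _.
  by rewrite !mxE mulrC.
apply: memv_suml => i _; apply/memvZ/memv_span/mapP.
by exists i; rewrite ?mem_enum.
Qed.

Lemma krylov_pow n (A : 'M[R]_n) (w : 'cV[R]_n) i m :
  (i < m)%N -> A ^+ i *m w \in krylov m A w.
Proof.
by move=> im; apply/memv_span/mapP; exists i => //; rewrite mem_iota.
Qed.

Lemma krylov_subv n (A : 'M[R]_n) (w : 'cV[R]_n) i m :
  (i <= m)%N -> (krylov i A w <= krylov m A w)%VS.
Proof.
move=> im; apply/span_subvP => _ /mapP[l + ->]; rewrite mem_iota => li.
by rewrite krylov_pow // (leq_trans _ im).
Qed.

Lemma mulmx_krylov n (A : 'M[R]_n) (w x : 'cV[R]_n) m :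
  x \in krylov m A w -> A *m x \in krylov m.+1 A w.
Proof.
set f := linfun (mulmx A : 'cV[R]_n -> 'cV[R]_n).
move=> xK; rewrite -[A *m x](lfunE _ x) -/f.
suff: (f @: krylov m A w <= krylov m.+1 A w)%VS.
  by move/subvP; apply; exact: memv_img.
rewrite limg_span; apply/span_subvP => _ /mapP[_ /mapP[l + ->] ->].
rewrite mem_iota lfunE /= mulmxA => lm.
by rewrite [A *m _](esym (exprS A l)) krylov_pow.
Qed.

Variables (n j : nat) (A : 'M[R]_n) (w0 : 'cV[R]_n).
Variables (V : 'M[R]_(n, j.+1)) (H : 'M[R]_(j.+1, j)).
Hypothesis VH : arnoldi A w0 V H.

Let w0_neq0 : norm2 w0 != 0.
Proof.
have [w0n _ _] := VH; apply: contra_neq w0n => n0.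
by apply: sqnorm_eq0; rewrite -norm2_sqr n0 expr0n.
Qed.

Lemma arnoldi_col m :
  A *m col m (init_cols V) =
  H (lift ord0 m) m *: col (lift ord0 m) V
  + \sum_(i < j.+1 | (i <= m)%N) H i m *: col i V.
Proof. by have [_ _ /(_ m)[_ -> _ _ _]] := VH; rewrite subrK. Qed.

Lemma col_init_cols m :
  col m (init_cols V) = col (widen_ord (leqnSn j) m) V.
Proof. by apply/colP => l; rewrite !mxE. Qed.

(** Column [m] of [V *m H] splits by the row index of [H]: rows up to [m] give the orthogonalization
    sum, row [m + 1] gives the remainder, and the later rows vanish by the Hessenberg condition. *)
Lemma arnoldi_relation : A *m init_cols V = V *m H.
Proof.
apply/matrixP => l m.
have -> : (A *m init_cols V) l m = (A *m col m (init_cols V)) l 0.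
  by rewrite colE mulmxA -colE [RHS]mxE.
rewrite arnoldi_col [LHS]mxE summxE [RHS]mxE.
have [_ _ /(_ m)[_ _ _ _ H0]] := VH.
rewrite [RHS](bigID (fun i : 'I_j.+1 => (i <= m)%N)) /= addrC; congr (_ + _).
  by apply: eq_bigr => i _; rewrite !mxE mulrC.
rewrite (bigD1 (lift ord0 m)); last by rewrite lift0 ltnn.
rewrite /= big1 ?addr0.
  by rewrite !mxE mulrC.
move=> i /andP[]; rewrite -ltnNge leq_eqVlt => /orP[/eqP mi /eqP[]|mi _].
  exact/val_inj/esym.
by rewrite H0 ?mulr0.
Qed.

Let dot_col i l : (V^T *m V) i l = ((col i V)^T *m col l V) 0 0.
Proof. by rewrite !mxE; apply: eq_bigr => s _; rewrite !mxE. Qed.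

(** Induction on the number of leading columns: the coefficients are the inner products with
    [A v_m], so the remainder is orthogonal to the earlier columns, and each step normalizes it. *)
Lemma arnoldi_orthonormal : V^T *m V = 1%:M.
Proof.
have [_ V0 step] := VH.
suff G m : forall i l : 'I_j.+1, (i <= m)%N -> (l <= m)%N ->
    (V^T *m V) i l = (i == l)%:R.
  by apply/matrixP => i l; rewrite (G j) ?[RHS]mxE // -ltnS.
elim: m => [|m IH] i l.
  rewrite !leqn0 => /eqP i0 /eqP l0.
  have -> : i = ord0 by exact: val_inj.
  have -> : l = ord0 by exact: val_inj.
  rewrite eqxx dot_col V0 sqnormZ -norm2_sqr -exprMn.
  by rewrite mulVf ?expr1n.
have sym (s t : 'I_j.+1) : (V^T *m V) s t = (V^T *m V) t s.
  by rewrite -[in LHS](trmxK V) -trmx_mul trmxK mxE.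
(* By symmetry [l] is the later index, so the only new case is [l = m + 1]. *)
wlog il : i l / (i <= l)%N.
  move=> wl im lm; have [il|/ltnW li] := leqP i l; first exact: wl.
  by rewrite sym eq_sym; exact: wl.
move=> _; rewrite leq_eqVlt ltnS => /orP[/eqP lm|lm]; last first.
  by apply: IH => //; exact: leq_trans lm.
have mj : (m < j)%N by rewrite -ltnS -lm.
pose mo := Ordinal mj.
have [Hdot Hstep norm1 hn0 _] := step mo.
have lE : l = lift ord0 mo by exact: val_inj.
move: il; rewrite leq_eqVlt => /orP[/eqP/val_inj->|].
  by rewrite eqxx dot_col -norm2_sqr lE norm1 expr1n.
rewrite lm ltnS => im.
rewrite (_ : (i == l) = false); last by apply/eqP => E; rewrite E lm ltnn in im.
(* Multiplying by the nonzero subdiagonal entry replaces [v_(m+1)] by the remainder of step [m]. Its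
   inner product with [v_i] is [h_(i,m) - h_(i,m)], by orthonormality of the earlier columns. *)
apply: (mulfI hn0); rewrite mulr0.
have -> : H (lift ord0 mo) mo * (V^T *m V) i l =
    ((col i V)^T *m (H (lift ord0 mo) mo *: col (lift ord0 mo) V)) 0 0.
  by rewrite dot_col lE -scalemxAr [RHS]mxE.
rewrite Hstep mulmxBr mulmx_sumr [LHS]mxE -Hdot // [X in _ + X]mxE summxE.
rewrite (bigD1 i) //= big1 => [|s /andP[sm si]].
  by rewrite -scalemxAr mxE -dot_col IH // eqxx mulr1 addr0 subrr.
by rewrite -scalemxAr mxE -dot_col IH // eq_sym (negPf si) mulr0.
Qed.

(** Dividing by the nonzero subdiagonal entry expresses [v_(m+1)] through [A v_m] and the earlier
    columns. Columns are counted from 0, hence the order [m.+1]. *)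
Let col_krylov m (l : 'I_j.+1) : (l <= m)%N -> col l V \in krylov m.+1 A w0.
Proof.
have [_ V0 step] := VH.
elim: m l => [|m IH] l.
  rewrite leqn0 => /eqP l0; have -> : l = ord0 by exact: val_inj.
  rewrite V0 memvZ //.
  by have := krylov_pow A w0 (ltn0Sn 0); rewrite expr0 mul1mx.
rewrite leq_eqVlt ltnS => /orP[/eqP lm|lm]; last first.
  by move/subvP: (krylov_subv A w0 (leqnSn m.+1)); apply; exact: IH.
have mj : (m < j)%N by rewrite -ltnS -lm.
pose mo := Ordinal mj.
have [_ Hstep _ hn0 _] := step mo.
have -> : l = lift ord0 mo by exact: val_inj.
rewrite -(scalerK hn0 (col _ V)) memvZ // Hstep rpredB //.
  by rewrite mulmx_krylov // col_init_cols IH.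
apply: memv_suml => i im; apply: memvZ.
by move/subvP: (krylov_subv A w0 (leqnSn m.+1)); apply; exact: IH.
Qed.

(** The reverse inclusion. Letting [E] vary makes the induction hypothesis available at the preimage
    of [E] under [A], since [A v_l] combines only [v_0], ..., [v_(l+1)]. *)
Let pow_colspan m (E : {vspace 'cV[R]_n}) : (m <= j)%N ->
  (forall l : 'I_j.+1, (l <= m)%N -> col l V \in E) -> A ^+ m *m w0 \in E.
Proof.
have [_ V0 _] := VH.
elim: m E => [|m IH] E mj VE.
  rewrite expr0 mul1mx -(scalerK (invr_neq0 w0_neq0) w0) -V0 memvZ //.
  exact: VE.
set f := linfun (mulmx A : 'cV[R]_n -> 'cV[R]_n).
have : A ^+ m *m w0 \in (f @^-1: E)%VS.
  apply: IH => [|l lm]; first exact: ltnW.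
  rewrite -memv_preim lfunE /=.
  have lj : (l < j)%N by exact: leq_ltn_trans mj.
  have -> : l = widen_ord (leqnSn j) (Ordinal lj) by exact: val_inj.
  rewrite -col_init_cols arnoldi_col rpredD //.
    exact/memvZ/VE.
  apply: memv_suml => i il; apply/memvZ/VE.
  exact: leq_trans il (leqW lm).
by rewrite -memv_preim lfunE /= mulmxA [A *m _](esym (exprS A m)).
Qed.

Lemma krylov_init_cols : krylov j A w0 = colspace (init_cols V).
Proof.
apply/eqP; rewrite eqEsubv; apply/andP; split; apply/span_subvP => _ /mapP[i + ->].
  rewrite mem_iota => /= ij; apply: pow_colspan => [|l li]; first exact: ltnW.
  have lj : (l < j)%N by exact: leq_ltn_trans ij.
  apply/memv_span/mapP; exists (Ordinal lj); first by rewrite mem_enum.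
  by rewrite col_init_cols; congr (col _ V); exact: val_inj.
move=> _; rewrite col_init_cols.
by move/subvP: (krylov_subv A w0 (ltn_ord i)); apply; exact: col_krylov.
Qed.

End Arnoldi.

Theorem theorem4p1 (R : realType) (n j k : nat) (A : 'M[R]_n)
    (b x0 w0 : 'cV[R]_n) (V : 'M[R]_(n, j.+1)) (H : 'M[R]_(j.+1, j))
    (U : 'M[R]_(n, k)) :
  let r0 := b - A *m x0 in
  let Vj := init_cols V in
  let C := A *m U in
  let Phi := C *m C^T in
  let D := V^T *m C in
  w0 = r0 \/ w0 = A *m r0 ->
  arnoldi A w0 V H ->
  C^T *m C = 1%:M ->
  forall (y : 'cV[R]_j) (z : 'cV[R]_k),
  let y_equation :=
    (H^T *m H - H^T *m D *m D^T *m H) *m y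
      = H^T *m (V^T *m ((1%:M - Phi) *m r0)) in
  let z_equation := z = C^T *m r0 - D^T *m H *m y in
  [/\ minimizer_on (fun d => d \in (colspace U + krylov j A w0)%VS)
        (fun d => norm2 (b - A *m (x0 + d))) (U *m z + Vj *m y)
        <-> y_equation /\ z_equation,
      minimizer_on (fun _ : 'cV[R]_j * 'cV[R]_k => True)
        (fun p => norm2 (b - A *m (x0 + Vj *m p.1 + U *m p.2))) (y, z)
        <-> y_equation /\ z_equation &
      y_equation <->
      minimizer_on (fun t => t \in krylov j A w0)
        (fun t => norm2 ((1%:M - Phi) *m (b - A *m (x0 + t)))) (Vj *m y)].
Proof.
move=> r0 Vj C Phi D _ VH CC y z yeq zeq.
have AVj : A *m Vj = V *m H := arnoldi_relation VH.
have VV := arnoldi_orthonormal VH.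
have KV := krylov_init_cols VH.
have DT : D^T = C^T *m V by rewrite trmx_mul trmxK.
have resE y' z' :
    b - A *m (x0 + Vj *m y' + U *m z') =
    r0 - row_mx (V *m H) C *m col_mx y' z'.
  by rewrite mul_row_col -AVj !mulmxDr !mulmxA !opprD !addrA.
have projE (P : 'M[R]_n) y' :
    P *m (b - A *m (x0 + Vj *m y')) = P *m r0 - P *m (V *m H) *m y'.
  by rewrite (mulmxDr A) (mulmxA A Vj) AVj opprD addrA -/r0 mulmxBr !mulmxA.
(* From here [r0] and [C] are atoms; [resE] and [projE] keep their link to the residuals. *)
clearbody r0 C.
(* Common core of the first two claims: minimality in the coordinates [(y, z)]. *)
have joint : (forall p : 'cV[R]_j * 'cV[R]_k,
    norm2 (b - A *m (x0 + Vj *m y + U *m z)) <=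
    norm2 (b - A *m (x0 + Vj *m p.1 + U *m p.2))) <-> yeq /\ zeq.
  apply: (iff_trans (B := forall q, norm2 (r0 - row_mx (V *m H) C *m col_mx y z)
      <= norm2 (r0 - row_mx (V *m H) C *m q))).
    split=> [pmin q|pmin p]; last by rewrite !resE.
    by have := pmin (usubmx q, dsubmx q); rewrite !resE vsubmxK.
  apply: (iff_trans (normal_equationP _ _ _)).
  rewrite tr_row_mx mul_col_mx mul_row_col.
  set e := r0 - _.
  have Ce : C^T *m e = C^T *m r0 - D^T *m H *m y - z.
    by rewrite /e mulmxBr mulmxDr !mulmxA CC mul1mx DT opprD addrA.
  (* Inserting the value of [z] turns [e] into [(I - Phi) (r0 - V H y)]. Multiplying by [(V H)^T]
     and using [V^T V = I] leaves the difference of the two sides of the equation for [y]. *)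
  have VHe : zeq -> (V *m H)^T *m e =
      H^T *m (V^T *m ((1%:M - Phi) *m r0))
      - (H^T *m H - H^T *m D *m D^T *m H) *m y.
    rewrite /e /zeq => ->; rewrite trmx_mul /Phi /D.
    rewrite trmx_mul trmxK !(mulmxBr, mulmxBl, mulmxDr) !mulmxN !mulmxA mulmx1.
    rewrite -(mulmxA H^T V^T V) VV mulmx1 !opprD !opprK !addrA.
    by congr (_ + _); rewrite addrAC.
  (* The block of [C] comes first: it yields the equation for [z], which [VHe] assumes. *)
  split=> [/eqP|[ye ze]].
    rewrite col_mx_eq0 => /andP[/eqP e1 /eqP e2].
    have ze : zeq by apply/eqP; rewrite /zeq eq_sym -subr_eq0 -Ce e2.
    split=> //; apply/eqP; rewrite /yeq eq_sym -subr_eq0 -VHe //.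
    exact/eqP.
  by rewrite (VHe ze) Ce -ze -ye !subrr col_mx0.
split.
- have sumP d : d \in (colspace U + krylov j A w0)%VS <->
      exists p : 'cV[R]_j * 'cV[R]_k, d = U *m p.2 + Vj *m p.1.
    rewrite KV; split=> [/memv_addP[u uU [v vV ->]]|[[y' z'] ->]].
      have [z' ->] := (colspaceP U u).1 uU.
      by have [y' ->] := (colspaceP Vj v).1 vV; exists (y', z').
    by apply: memv_add; apply/colspaceP; [exists z'|exists y'].
  apply: (iff_trans (minimizer_on_image _ (y, z) sumP)); apply: iff_trans joint.
  have swap (p : 'cV[R]_j * 'cV[R]_k) :
      x0 + (U *m p.2 + Vj *m p.1) = x0 + Vj *m p.1 + U *m p.2.
    by rewrite addrA addrAC.
  by split=> pmin p; have := pmin p; rewrite !swap.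
- by split=> [[_ pmin]|/joint pmin]; [apply/joint => p; exact: pmin|].
have spanP t : t \in krylov j A w0 <-> exists y, t = Vj *m y.
  by rewrite KV; exact: colspaceP.
apply: iff_sym; apply: (iff_trans (minimizer_on_image _ y spanP)).
set P := 1%:M - Phi.
have PT : P^T = P by rewrite /P /Phi linearB /= trmx1 trmx_mul trmxK.
have PP : P *m P = P.
  rewrite /P mulmxBr mulmx1 mulmxBl mul1mx /Phi !mulmxA -(mulmxA C) CC mulmx1.
  by rewrite subrr subr0.
(* As [P^T P = P], a single projector survives, and [(V H)^T P (V H)] is the matrix
   [H^T H - H^T D D^T H]. *)
have ne : (P *m (V *m H))^T *m (P *m r0 - P *m (V *m H) *m y) =
    H^T *m (V^T *m (P *m r0)) - (H^T *m H - H^T *m D *m D^T *m H) *m y.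
  rewrite trmx_mul PT trmx_mul mulmxBr !mulmxA -!(mulmxA _ P P) PP.
  congr (_ - _ *m _); rewrite DT /D /P /Phi !(mulmxBr, mulmxBl) mulmx1 !mulmxA.
  by rewrite -(mulmxA H^T V^T V) VV mulmx1.
have lsq : (forall y', norm2 (P *m (b - A *m (x0 + Vj *m y))) <=
    norm2 (P *m (b - A *m (x0 + Vj *m y')))) <->
    (P *m (V *m H))^T *m (P *m r0 - P *m (V *m H) *m y) = 0.
  apply: iff_trans (normal_equationP _ _ _).
  by split=> pmin y'; have := pmin y'; rewrite !projE.
apply: (iff_trans lsq); rewrite ne /yeq.
by split=> [/eqP|->]; [rewrite subr_eq0 => /eqP|rewrite subrr].
Qed.
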